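(* Let $\{p_{\varepsilon,\lambda}\}$ be a family of probability densities with respect to a measure $\varpi$, defined for $(\varepsilon,\lambda)$ near $(0,0)$ (with $\varepsilon$ ranging either over a two-sided neighbourhood of $0$ or over a one-sided neighbourhood $\varepsilon\ge 0$, in which case derivatives in $\varepsilon$ are one-sided), and put $$\Phi(\varepsilon,\lambda)=2\sqrt{p_{\varepsilon,\lambda}}\in L^2(\varpi).$$ Assume that $\Phi$ is twice continuously Fréchet differentiable at $(0,0)$ as an $L^2(\varpi)$-valued map, and that $\Phi(0,\lambda)=\Phi(0,-\lambda)$ for all sufficiently small $|\lambda|$. Define $$\mathfrak h_-=\partial^2_{\varepsilon\lambda}\Phi(0,0),\qquad \mathfrak h_+=\partial^2_{\lambda\lambda}\Phi(0,0).$$ Then $$\Phi(\varepsilon,\lambda)-\Phi(\varepsilon,0)=\varepsilon\lambda\,\mathfrak h_-+\frac{\lambda^2}{2}\,\mathfrak h_++o_{L^2(\varpi)}\bigl(|\varepsilon||\lambda|+\lambda^2\bigr)$$ as $(\varepsilon,\lambda)\to(0,0)$. (Thus the first signed direction that can reappear away from the face $\varepsilon=0$ is mixed, whereas the first direction surviving on $\varepsilon=0$ is even in $\lambda$.)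
   Context: ''Twice continuously Fréchet differentiable at $(0,0)$'' means $C^2$ as a Hilbert-space-valued map in a neighbourhood of $(0,0)$ (relative to $\varepsilon\ge0$ in the one-sided case). The notation $o_{L^2(\varpi)}(a)$ denotes an element of $L^2(\varpi)$ whose norm is $o(a)$. *)

(* Defs.v *)
From HB Require Import structures.
From mathcomp Require Import all_boot all_order all_algebra.
From mathcomp Require Import all_classical all_reals all_analysis.
From mathcomp Require Import measurable_realfun ess_sup_inf.
Set Implicit Arguments.
Unset Strict Implicit.
Unset Printing Implicit Defensive.
Import Order.TTheory GRing.Theory Num.Theory.
Import numFieldNormedType.Exports.
Local Open Scope classical_set_scope.
Local Open Scope ring_scope.

(** The library defines [LspaceType mu p1] as a type of almost-everywhere classes
    without any algebraic or topological structure; this section makes it a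
    [normedModType] for the L^p norm, operations being computed on
    representatives. *)
Section Lspace_normed.
Context d (T : measurableType d) (R : realType).
Variables (mu : {measure set T -> \bar R}) (p : \bar R) (p1 : (1 <= p)%E).
Local Notation L := (LspaceType mu p1).

HB.instance Definition _ := gen_eqMixin L.
HB.instance Definition _ := gen_choiceMixin L.

Lemma Lspace_eqP (f g : L) : f = g %[ae mu] -> f = g.
Proof.
case: f g => [f [[fP]]] [g [[gP]]] /= fg.
have e : f = g by rewrite -[f]reprK -[g]reprK; apply/eqquotP/asboolP; exact: fg.
by subst g; do 3 f_equal; exact: Prop_irrelevance.
Qed.

Lemma eq_ae_Lnorm (f g : T -> R) : measurable_fun setT f ->
  measurable_fun setT g -> f = g %[ae mu] ->
  ('N[mu]_p[EFin \o f] = 'N[mu]_p[EFin \o g])%E.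
Proof.
move=> mf mg fg.
have mabs (h : T -> R) (r : R) : measurable_fun setT h ->
    measurable_fun setT ((fun x => `|(EFin \o h) x| `^ r)%E : T -> \bar R).
  move=> mh; apply: (@measurableT_comp _ _ _ _ _ _ (fun x => x `^ r)%E) => //=.
    exact: (measurableT_comp (measurable_poweR _)).
  by do 2 apply: measurableT_comp => //.
rewrite unlock; case: p p1 => [r r1|_|//].
  congr (_ `^ _)%E; apply: ae_eq_integral => //.
  - exact: mabs.
  - exact: mabs.
  - by apply: filterS fg => x /= fg _; rewrite fg.
case: ifPn => // _; apply: eq_ess_sup.
by apply: filterS fg => x /= ->.
Qed.

Lemma measurable_Lspace (f : L) : measurable_fun setT (f : T -> R).
Proof. exact: (@measurable_funPT _ _ _ _ (repr (LebesgueSpace.sort f))). Qed.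

Lemma Lspace_Lfun (f : L) : (f : T -> R) \in Lfun mu p.
Proof.
apply/andP; split; rewrite inE/=; first exact: measurable_Lspace.
exact: Lebesgue_finite.
Qed.

Definition Lspace_fun (f : L) : LfunType mu p1 := Lfun_Sub p1 (Lspace_Lfun f).

Section class.
Variable f : LfunType mu p1.

Let g0 : T -> measurableTypeR R := f.

Let mg0 : measurable_fun setT g0.
Proof. exact: (@measurable_funPT _ _ _ _ f). Qed.

HB.instance Definition _ := isMeasurableFun.Build _ _ _ _ g0 mg0.

Let g : {mfun T >-> measurableTypeR R} := g0.

Let Lclass0 : {mfun_ mu, T >-> measurableTypeR R} :=
  (\pi_({mfun_ mu, T >-> measurableTypeR R})%qT g)%R.

Let Lclass0E : (Lclass0 : T -> R) = f %[ae mu].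
Proof.
have : (repr Lclass0 == g %[mod {mfun_ mu, T >-> measurableTypeR R}])%qT.
  by rewrite reprK.
by rewrite eqmodE => /asboolP.
Qed.

Let Lclass0_fin : finite_norm mu p Lclass0.
Proof.
rewrite /finite_norm (@eq_ae_Lnorm _ f)//; last first.
  exact: (@measurable_funPT _ _ _ _ (repr Lclass0)).
exact: Lfunction_finite.
Qed.

HB.instance Definition _ := @isFinLebesgue.Build d T R mu p p1 Lclass0 Lclass0_fin.

Definition Lclass : L := Lclass0.

Lemma LclassE : (Lclass : T -> R) = f %[ae mu].
Proof. exact: Lclass0E. Qed.

End class.

Lemma Lspace_funK (f : L) : Lclass (Lspace_fun f) = f.
Proof. exact/Lspace_eqP/LclassE. Qed.

Lemma Lclass_eq (f g : LfunType mu p1) :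
  (f : T -> R) = g %[ae mu] -> Lclass f = Lclass g.
Proof.
move=> fg; apply: Lspace_eqP.
exact: ae_eq_trans (LclassE f) (ae_eq_trans fg (ae_eq_sym (LclassE g))).
Qed.

Definition Lspace_add (f g : L) : L := Lclass (Lspace_fun f + Lspace_fun g).
Definition Lspace_opp (f : L) : L := Lclass (- Lspace_fun f).
Definition Lspace_scale (a : R) (f : L) : L := Lclass (a *: Lspace_fun f).

Lemma Lspace_addE f g : Lspace_add (Lclass f) (Lclass g) = Lclass (f + g).
Proof.
apply: Lclass_eq; have := LclassE f; have := LclassE g.
by apply: filterS2 => x /= gx fx _; congr (_ + _); [exact: fx|exact: gx].
Qed.

Lemma Lspace_oppE f : Lspace_opp (Lclass f) = Lclass (- f).
Proof.
apply: Lclass_eq; have := LclassE f.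
by apply: filterS => x /= fx _; congr (- _); exact: fx.
Qed.

Lemma Lspace_scaleE a f : Lspace_scale a (Lclass f) = Lclass (a *: f).
Proof.
apply: Lclass_eq; have := LclassE f.
by apply: filterS => x /= fx _; congr (_ * _); exact: fx.
Qed.

Lemma Lspace_ind (P : L -> Prop) : (forall f, P (Lclass f)) -> forall u, P u.
Proof. by move=> Pf u; rewrite -(Lspace_funK u). Qed.

Let addA : associative Lspace_add.
Proof.
by do 3 elim/Lspace_ind => ?; rewrite !Lspace_addE addrA.
Qed.

Let addC : commutative Lspace_add.
Proof. by do 2 elim/Lspace_ind => ?; rewrite !Lspace_addE addrC. Qed.

Let add0 : left_id (Lclass 0) Lspace_add.
Proof. by elim/Lspace_ind => ?; rewrite !Lspace_addE add0r. Qed.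

Let addN : left_inverse (Lclass 0) Lspace_opp Lspace_add.
Proof.
by elim/Lspace_ind => ?; rewrite Lspace_oppE !Lspace_addE addNr. Qed.

HB.instance Definition _ := GRing.isZmodule.Build L addA addC add0 addN.

Lemma LclassD f g : Lclass f + Lclass g = Lclass (f + g).
Proof. exact: Lspace_addE. Qed.

Lemma LclassN f : - Lclass f = Lclass (- f).
Proof. exact: Lspace_oppE. Qed.

Let scaleA a b v : Lspace_scale a (Lspace_scale b v) = Lspace_scale (a * b) v.
Proof. by elim/Lspace_ind: v => ?; rewrite !Lspace_scaleE scalerA. Qed.

Let scale1 : left_id 1 Lspace_scale.
Proof. by elim/Lspace_ind => ?; rewrite !Lspace_scaleE scale1r. Qed.

Let scaleDr : right_distributive Lspace_scale +%R.
Proof.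
move=> a; do 2 elim/Lspace_ind => ?.
by rewrite !(LclassD, Lspace_scaleE) scalerDr.
Qed.

Let scaleDl v : {morph Lspace_scale^~ v : a b / a + b}.
Proof.
move=> a b; elim/Lspace_ind: v => ?.
by rewrite /= !Lspace_scaleE LclassD scalerDl.
Qed.

HB.instance Definition _ :=
  GRing.Zmodule_isLmodule.Build R L scaleA scale1 scaleDr scaleDl.

Lemma LclassZ a f : a *: Lclass f = Lclass (a *: f).
Proof. exact: Lspace_scaleE. Qed.

Definition Lspace_norm (f : L) : R := fine ('N[mu]_p[EFin \o (f : T -> R)])%E.

Let normE f : Lspace_norm (Lclass f) = fine ('N[mu]_p[EFin \o f])%E.
Proof.
congr fine; apply: eq_ae_Lnorm; [exact: measurable_Lspace|by []|exact: LclassE].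
Qed.

Let normD f g : Lspace_norm (f + g) <= Lspace_norm f + Lspace_norm g.
Proof.
elim/Lspace_ind: f => f; elim/Lspace_ind: g => g.
by rewrite LclassD !normE ler_LnormD.
Qed.

Let normZ a f : Lspace_norm (a *: f) = `|a| * Lspace_norm f.
Proof.
elim/Lspace_ind: f => f; rewrite LclassZ !normE.
by rewrite [X in fine X](LnormZ f a) fineM// -finite_norm_fine.
Qed.

Let norm0 f : Lspace_norm f = 0 -> f = 0.
Proof.
elim/Lspace_ind: f => f; rewrite normE => /fine_Lnormr_eq0 f0.
exact: Lclass_eq.
Qed.

HB.instance Definition _ := Lmodule_isNormed.Build R L normD normZ norm0.

Lemma Lspace_normE (f : L) : `|f| = fine ('N[mu]_p[EFin \o (f : T -> R)])%E.
Proof. by []. Qed.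

End Lspace_normed.

Section Lspace_class.
Context d (T : measurableType d) (R : realType).
Variables (mu : {measure set T -> \bar R}) (p : \bar R) (p1 : (1 <= p)%E).

(** Junk value [0] outside of L^p. *)
Definition toLspace (f : T -> R) : LspaceType mu p1 :=
  if pselect (f \in Lfun mu p) is left fP then Lclass (Lfun_Sub p1 fP) else 0.

Lemma toLspaceE (f : T -> R) : f \in Lfun mu p ->
  (toLspace f : T -> R) = f %[ae mu].
Proof.
by move=> fP; rewrite /toLspace; case: pselect => // {}fP; exact: LclassE.
Qed.
End Lspace_class.

Definition is_density d (T : measurableType d) (R : realType)
    (mu : {measure set T -> \bar R}) (q : T -> R) : Prop :=
  [/\ measurable_fun setT q, forall x, 0 <= q x & (\int[mu]_x (q x)%:E = 1)%E].

(** [sqrt_density_Lfun] below shows that [toLspace] does not take its junk value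
    here when [p z.1 z.2] is a density. *)
Definition sqrt_map d (T : measurableType d) (R : realType)
    (mu : {measure set T -> \bar R}) (p : R -> R -> T -> R) (z : R * R) :
    LspaceType2 mu :=
  toLspace mu (lee1n 2) (fun x => 2 * Num.sqrt (p z.1 z.2 x)).

Lemma sqrt_density_Lfun d (T : measurableType d) (R : realType)
    (mu : {measure set T -> \bar R}) (q : T -> R) : is_density mu q ->
  (fun x => 2 * Num.sqrt (q x)) \in Lfun mu 2%:R%:E.
Proof.
move=> [mq q0 q1].
have mf : measurable_fun setT (fun x => 2 * Num.sqrt (q x)).
  apply: measurable_funM => //; apply: (measurableT_comp (f := @Num.sqrt R)) => //.
  exact: (continuous_measurable_fun (@sqrt_continuous R)).
apply/andP; split; rewrite inE; first exact: mf.
rewrite /= /finite_norm unlock; set I := (\int[mu]_x _)%E.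
suff -> : I = 4%:E by rewrite poweR_EFin ltry.
transitivity (\int[mu]_x (4%:E * (q x)%:E))%E.
  apply: eq_integral => x _ /=.
  rewrite powR_mulrn// ger0_norm ?mulr_ge0 ?sqrtr_ge0//.
  by rewrite exprMn sqr_sqrtr// -EFinM -natrX.
rewrite ge0_integralZl_EFin ?q1 ?mule1//; last exact/measurable_EFinP.
by move=> x _; rewrite lee_fin.
Qed.

(** Differential calculus relative to a set [D]: the library's Fréchet
    differential, taken along the filter [within D (nbhs z)], and its iterate.
    The differential is meaningful when it is unique, e.g. for a half-plane [D]. *)
Section Frechet.
Context {R : realType} {V W : normedModType R}.
Implicit Types (D : set V) (f : V -> W) (z : V).

Definition diff_within D f z : {linear V -> W} := 'd f (within D (nbhs z)).

(** [B] is the Fréchet differential at [z] of [diff_within D f], valued in the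
    continuous linear maps with the operator norm; bounds on operator norms are
    spelled out, [B] being a bounded bilinear map, identified with a bounded
    linear map from [V] to the bounded linear maps from [V] to [W]. *)
Definition is_diff2_within D f z (B : {bilinear V -> V -> W}) : Prop :=
  (exists M : R, forall h k, `|B h k| <= M * `|h| * `|k|) /\
  (forall e : R, 0 < e -> \forall y \near within D (nbhs z), forall k,
    `|diff_within D f y k - diff_within D f z k - B (y - z) k|
      <= e * `|y - z| * `|k|).

(** [f] is C^2 on a neighbourhood of [z0] relative to [D]. *)
Definition C2_within D f z0 : Prop :=
  exists B : V -> {bilinear V -> V -> W},
    \forall z \near within D (nbhs z0),
      [/\ differentiable f (within D (nbhs z)),
          is_diff2_within D f z (B z) &
          forall e : R, 0 < e -> \forall y \near within D (nbhs z),
            forall h k, `|B y h k - B z h k| <= e * `|h| * `|k|].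

Lemma lim_within D z : D z -> lim (within D (nbhs z)) = z.
Proof.
move=> Dz; have PF : ProperFilter (within D (nbhs z)).
  exact: within_nbhs_proper (subset_closure Dz).
apply: (@cvg_lim _ _ _ (within D (nbhs z)) PF id) => //.
exact: cvg_within.
Qed.

Lemma differentiable_withinP D f z : D z ->
  differentiable f (within D (nbhs z)) <->
  continuous (diff_within D f z) /\
  (forall e : R, 0 < e -> \forall y \near within D (nbhs z),
    `|f y - f z - diff_within D f z (y - z)| <= e * `|y - z|).
Proof.
move=> Dz; rewrite diffP (lim_within Dz).
have oP (F : filter_on V) (g : V -> W) :
    (forall y, f y = g y +o_(y \near F) (y - z)) <->
    (forall e : R, 0 < e -> \forall y \near F, `|f y - g y| <= e * `|y - z|).
  split => [fg|fg y].
    by apply/(@eqaddoP _ _ _ _ F f g (fun y => y - z))/funext.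
  by have /eqaddoP/(congr1 (@^~ y)) := fg.
have := oP (within_filter_on D (nbhs_filter_on z))
  (fun y => f z + diff_within D f z (y - z)) => {}oP.
split=> -[cd fd]; split=> //.
  move=> e e0; have := oP.1 fd e e0.
  by apply: filterS => y; rewrite opprD addrA.
apply: oP.2 => e e0; have := fd e e0.
by apply: filterS => y; rewrite opprD addrA.
Qed.

End Frechet.

(** One-variable derivative at [a] of a map defined on [E]: one-sided at an
    endpoint of [E], and the library's [derive1] when [E] is the whole line. *)
Definition derive1_within {R : realType} {W : normedModType R} (E : set R)
    (g : R -> W) (a : R) : W :=
  lim ((fun h => h^-1 *: (g (h + a) - g a)) @ within [set h | E (h + a)] 0^').

Lemma derive1_withinT (R : realType) (W : normedModType R) (g : R -> W) :
  derive1_within setT g = derive1 g.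
Proof.
apply/funext => a; rewrite /derive1_within /derive1; congr (lim (_ @ _)).
rewrite (_ : [set h | _] = setT); last by apply/seteqP; split.
by rewrite withinET.
Qed.

(* Main.v *)
Require Import Defs.
From mathcomp Require Import all_boot all_order all_algebra.
From mathcomp Require Import all_classical all_reals all_analysis.
From mathcomp Require Import measurable_realfun ring lra.
Import Order.TTheory GRing.Theory Num.Theory.
Import numFieldNormedType.Exports.
Local Open Scope classical_set_scope.
Local Open Scope ring_scope.
Set Implicit Arguments.
Unset Strict Implicit.

(** The expansion is a fact about a map [f] of two real variables into a normed
    space, applied to [f = Phi].

    Write [S z] for the partial derivative of [f] in the second variable, which
    is the value at [(0, 1)] of the differential of [f] at [z]. Since [f (0, l)]
    is even in [l], [S (0, 0) = 0]. The differential is itself differentiable at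
    the origin, so [S] has there the first-order expansion
    [S (x, s) = x *: hminus + s *: hplus + o(|x| + |s|)]; restricted to the two
    axes, it identifies the coefficients with the iterated derivatives of the
    theorem.

    It remains to integrate this in [s] from [0] to [l]. Subtracting from
    [f (x, s)] the polynomial [(x * s) *: hminus + (s ^+ 2 / 2) *: hplus] leaves
    a function of [s] with derivative [o(|x| + |l|)], and the mean value
    inequality gives an increment [o(|x| + |l|) * |l|], which is
    [o(|x| * |l| + l ^+ 2)] ([taylor_snd]). Only vertical segments are used, and
    they stay in the half-plane when [x] is a boundary parameter; this is why
    the one-sided case is no different, and why the error carries the factor
    [|l|] instead of being a generic second-order remainder.

    The mean value inequality for vector-valued functions is proved in the form
    that a function which is [K]-Lipschitz at each point, in a neighbourhood
    depending on the point, is [K]-Lipschitz on the segment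
    ([ler_dist_pointwise_lipschitz]). *)

(** * Mean value inequality *)

(** The mean value theorem fails for vector-valued functions; a supremum
    argument on the set of points reached by the bound replaces it. *)
Lemma ler_dist_pointwise_lipschitz (R : realType) (W : normedModType R)
    (g : R -> W) (K a b : R) : a <= b ->
  (forall s, a <= s <= b ->
    \forall t \near nbhs s, `|g t - g s| <= K * `|t - s|) ->
  `|g b - g a| <= K * (b - a).
Proof.
move=> ab gK.
(* The supremum s of A belongs to A by the estimate at s read from the left;
   read from the right, it would extend A beyond s if s were smaller than b. *)
pose A := [set t | a <= t <= b /\ `|g t - g a| <= K * (t - a)].
have Aa : A a by split; [rewrite lexx ab|rewrite !subrr normr0 mulr0].
have bA : ubound A b by move=> t [] /andP[].
have hA : has_sup A by split; [exists a|exists b].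
set s := sup A.
have sab : a <= s <= b.
  by rewrite (ub_le_sup hA.2 Aa) ge_sup//; exists a.
have [r /= r0 gr] := (nbhs_ballP _ _).1 (gK s sab).
have As : A s.
  split => //; have [t At ts] := sup_adherent r0 hA.
  have ts' : t <= s := ub_le_sup hA.2 At.
  have /gr : ball s r t.
    by rewrite /ball/= ger0_norm; [move: ts; rewrite -/s; lra|lra].
  rewrite /= ler0_norm; last by lra.
  move=> gts; have [_ gta] := At.
  rewrite (_ : g s - g a = (g s - g t) + (g t - g a)); last by rewrite addrA subrK.
  apply: le_trans (ler_normD _ _) _; rewrite distrC.
  by apply: le_trans (lerD gts gta) _; lra.
have [sb|sb] := ltP s b; last first.
  have <- : s = b by apply/eqP; rewrite eq_le sb andbT; case/andP: sab.
  by case: As.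
exfalso.
pose t := Num.min b (s + r / 2).
have st : s < t by rewrite lt_min sb ltrDl divr_gt0.
have tb : t <= b by rewrite ge_min lexx.
have tr : t <= s + r / 2 by rewrite ge_min lexx orbT.
have /gr : ball s r t by rewrite /ball/= ltr0_norm; lra.
rewrite /= ger0_norm; last by lra.
move=> gts; suff At : A t by have := ub_le_sup hA.2 At; rewrite leNgt st.
split; first by apply/andP; split => //; case/andP: sab => ? _; lra.
case: As => _ gsa.
rewrite (_ : g t - g a = (g t - g s) + (g s - g a)); last by rewrite addrA subrK.
apply: le_trans (ler_normD _ _) _.
by apply: le_trans (lerD gts gsa) _; lra.
Qed.

Lemma ler_dist0_pointwise_lipschitz (R : realType) (W : normedModType R)
    (g : R -> W) (K l : R) :
  (forall s, `|s| <= `|l| ->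
    \forall t \near nbhs s, `|g t - g s| <= K * `|t - s|) ->
  `|g l - g 0| <= K * `|l|.
Proof.
move=> gK; have [l0|l0] := leP 0 l.
  rewrite ger0_norm// -{2}[l]subr0; apply: ler_dist_pointwise_lipschitz => // s.
  by case/andP=> s0 sl; apply: gK; rewrite !ger0_norm.
rewrite distrC ltr0_norm// -[- l]add0r.
apply: ler_dist_pointwise_lipschitz => [|s /andP[ls s0]]; first exact: ltW.
by apply: gK; rewrite !ler0_norm ?lerN2 // ltW.
Qed.

(** * Derivatives relative to a set of reals *)

(** Characterizes the derivative without quotients or limits, so that it can be
    read off a Fréchet expansion and fed to the mean value inequality. *)
Definition has_deriv_within {R : realType} {W : normedModType R} (E : set R)
    (g : R -> W) (a : R) (v : W) : Prop :=
  forall e : R, 0 < e -> \forall y \near within E (nbhs a),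
    `|g y - g a - (y - a) *: v| <= e * `|y - a|.

Lemma has_deriv_within_near_eq (R : realType) (W : normedModType R) (E : set R)
    (g h : R -> W) (a : R) (v : W) : E a ->
  (\forall y \near within E (nbhs a), g y = h y) ->
  has_deriv_within E g a v -> has_deriv_within E h a v.
Proof.
move=> Ea gh gv e e0; have gha : g a = h a by exact: nbhs_singleton gh Ea.
by rewrite -gha; apply: filterS2 gh (gv e e0) => y <-.
Qed.

Lemma derive1_within_unique (R : realType) (W : normedModType R) (E : set R)
    (g : R -> W) (a : R) (v : W) : limit_point E a ->
  has_deriv_within E g a v -> derive1_within E g a = v.
Proof.
move=> La gv; rewrite /derive1_within; set F := within _ _.
have shift (P : R -> Prop) : (\forall y \near nbhs a, P y) ->
    \forall h \near nbhs (0 : R), P (h + a).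
  move=> /nbhs_ballP[r /= r0 rP]; apply/nbhs_ballP; exists r => //= h.
  rewrite /ball/= sub0r normrN => hr; apply: rP.
  by rewrite /ball/= opprD addrCA subrr addr0 normrN.
(* Uniqueness of limits needs a proper filter: a being a limit point of E is
   exactly that. *)
have FF : ProperFilter F.
  apply: Build_ProperFilter_ex => P FP; have : nbhs a (fun y =>
      y != a -> E y -> P (y - a)).
    move: FP => /nbhs_ballP[r /= r0 rP]; apply/nbhs_ballP; exists r => //= y.
    rewrite /ball/= => ya yna Ey; apply: rP => //=.
    - by rewrite /ball/= sub0r opprB.
    - by rewrite subr_eq0.
    - by rewrite subrK.
  by move=> /La[y [yna Ey /(_ yna Ey) Py]]; exists (y - a).
apply: cvg_lim => //; apply/cvgrPdist_le => e e0.
apply: filterS (shift _ (gv e e0)) => h + h0 Eh => /(_ Eh).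
rewrite addrK => gh.
rewrite -[v in v - _](scalerK h0) -scalerBr normrZ distrC normfV.
by rewrite ler_pdivrMl ?normr_gt0// mulrC.
Qed.

Lemma limit_point_setT (R : realType) (a : R) : limit_point setT a.
Proof.
move=> U /nbhs_ballP[r /= r0 rU]; exists (a + r / 2); split => //.
  by rewrite -subr_eq0 addrAC subrr add0r gt_eqF ?divr_gt0.
by apply: rU; rewrite /ball/= opprD addNKr normrN gtr0_norm; lra.
Qed.

Lemma limit_point_ge0 (R : realType) : limit_point [set e : R | 0 <= e] 0.
Proof.
move=> U /nbhs_ballP[r /= r0 rU]; exists (r / 2); split => /=.
- by rewrite gt_eqF ?divr_gt0.
- by rewrite divr_ge0 ?ltW.
- by apply: rU; rewrite /ball/= sub0r normrN gtr0_norm; lra.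
Qed.

Lemma derive1_unique (R : realType) (W : normedModType R)
    (g : R -> W) (a : R) (v : W) :
  has_deriv_within setT g a v -> derive1 g a = v.
Proof.
rewrite -derive1_withinT; apply: derive1_within_unique.
exact: limit_point_setT.
Qed.

(** The derivative [v] at [0] of an even function is also [- v]. *)
Lemma deriv_even0 (R : realType) (W : normedModType R) (g : R -> W) (v : W) :
  (\forall t \near nbhs (0 : R), g t = g (- t)) ->
  has_deriv_within setT g 0 v -> v = 0.
Proof.
move=> geven gv.
have gNv : has_deriv_within setT g 0 (- v).
  move=> e e0; have cN : - t @[t --> (0 : R)] --> (0 : R).
    by rewrite -[X in _ --> X]oppr0; apply: cvgN; exact: cvg_id.
  apply: filterS2 geven (cN _ (gv e e0)) => t gt /= + _ => /(_ I).
  by rewrite -gt !subr0 scalerN scaleNr normrN.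
have vN : v = - v by rewrite -(derive1_unique gNv); exact/esym/derive1_unique.
have /eqP : 2 *: v = 0 by rewrite scaler_nat mulr2n {2}vN subrr.
by rewrite scaler_eq0 pnatr_eq0 => /eqP.
Qed.

(** * Differentials of maps of two variables *)

(** Serves twice: for [f] with its differential, and for the differential of [f],
    evaluated at a fixed vector, with the second differential. *)
Lemma has_deriv_within_line (R : realType) (V W : normedModType R)
    (D : set V) (G A : V -> W) (z u : V) (E : set R) (y : R -> V) (a : R) :
  (forall (c : R) w, A (c *: w) = c *: A w) ->
  (forall t, y t = z + (t - a) *: u) ->
  (forall t, E t -> D (y t)) ->
  (forall e : R, 0 < e -> \forall w \near within D (nbhs z),
    `|G w - G z - A (w - z)| <= e * `|w - z|) ->
  has_deriv_within E (fun t => G (y t)) a (A u).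
Proof.
move=> AZ yE ED GA e e0.
have u1 : 0 < `|u| + 1 by rewrite ltr_wpDl.
have ya : y a = z by rewrite yE subrr scale0r addr0.
have cy : y t @[t --> a] --> z.
  have : z + (t - a) *: u @[t --> a] --> z + (a - a) *: u.
    apply: cvgD; first exact: cvg_cst.
    by apply: cvgZr_tmp; apply: cvgB; [exact: cvg_id|exact: cvg_cst].
  by rewrite subrr scale0r addr0 (_ : y = fun t => z + (t - a) *: u)//; exact/funext.
have : \forall t \near nbhs a, D (y t) ->
    `|G (y t) - G z - A (y t - z)| <= e / (`|u| + 1) * `|y t - z|.
  exact: cy (GA _ (divr_gt0 e0 u1)).
apply: filterS => t /= + Et => /(_ (ED _ Et)).
rewrite ya yE [z + _ - z]addrAC subrr add0r AZ => /le_trans; apply.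
rewrite normrZ mulrCA mulrC ler_wpM2r//.
by rewrite mulrAC ler_pdivrMr// ler_pM2l// lerDl.
Qed.

Lemma has_deriv_snd (R : realType) (W : normedModType R) (E : set R)
    (f : R * R -> W) (x l : R) (D : set (R * R) := E `*` setT) : E x ->
  differentiable f (within D (nbhs (x, l))) ->
  has_deriv_within setT (fun t => f (x, t)) l (diff_within D f (x, l) (0, 1)).
Proof.
move=> Ex df; have Dz : D (x, l) by [].
have [_ fL] := (differentiable_withinP f Dz).1 df.
apply: (has_deriv_within_line _ _ _ fL) => [c w|t|t _].
- exact: linearZ.
- by congr pair; rewrite /= /GRing.scale/= ?mulr0 ?addr0// mulr1 addrC subrK.
- by split.
Qed.

Lemma near_within_slice (R : realType) (V V' : normedModType R) (D : set V)
    (F : set V') (P : V -> Prop) (y : V' -> V) :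
  (forall t, `|y t| <= `|t|) -> (forall t, F t -> D (y t)) ->
  (\forall z \near within D (nbhs 0), P z) ->
  \forall t \near within F (nbhs 0), P (y t).
Proof.
move=> yt FD /nbhs_normP[r /= r0 rP]; apply/nbhs_normP; exists r => //= t.
rewrite /ball_/= sub0r normrN => tr Ft; apply: rP; last exact: FD.
by rewrite /ball_/= sub0r normrN (le_lt_trans (yt t)).
Qed.

(** * Second-order expansion of the vertical increment *)

(** Integrates the expansion of the partial derivative [S] along vertical
    segments, by the mean value inequality. *)
Lemma taylor_snd (R : realType) (W : normedModType R) (E : set R)
    (f S : R * R -> W) (u v : W) (D : set (R * R) := E `*` setT) :
  (\forall z \near within D (nbhs (0 : R * R)),
    has_deriv_within setT (fun t => f (z.1, t)) z.2 (S z)) ->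
  (forall e : R, 0 < e -> \forall z \near within D (nbhs (0 : R * R)),
    `|S z - (z.1 *: u + z.2 *: v)| <= e * `|z|) ->
  forall eps : R, 0 < eps -> \forall z \near within D (nbhs (0 : R * R)),
    `|f z - f (z.1, 0) - ((z.1 * z.2) *: u + (z.2 ^+ 2 / 2) *: v)|
      <= eps * (`|z.1| * `|z.2| + z.2 ^+ 2).
Proof.
move=> dS Sexp eps eps0.
(* A third of eps for each of: the derivative of f in s, the expansion of S,
   and the quadratic term in t - s. *)
have c0 : 0 < eps / 3 by rewrite divr_gt0.
set c := eps / 3 in c0.
have [r /= r0 rP] := (nbhs_ballP _ _).1 (filterI dS (Sexp c c0)).
apply/nbhs_ballP; exists r => //= -[x l] /= xlr [/= Ex _].
rewrite /=; have [->|l0] := eqVneq l 0.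
  by rewrite !mulr0 expr0n/= mul0r !scale0r addr0 !subrr !normr0 mulr0 addr0 mulr0.
have [xr lr] : `|x| < r /\ `|l| < r.
  by move: xlr => [] /=; rewrite /ball/= !sub0r !normrN.
set m := `|x| + `|l|; have m0 : 0 < m by rewrite ltr_wpDl// normr_gt0.
pose q s := (x * s) *: u + (s ^+ 2 / 2) *: v.
have qE s t : q t - q s =
    (t - s) *: (x *: u + s *: v) + ((t - s) ^+ 2 / 2) *: v.
  rewrite /q opprD addrACA -[X in X + _]scalerBl -[X in _ + X]scalerBl.
  rewrite scalerDr !scalerA -[RHS]addrA -scalerDl.
  by congr (_ *: _ + _ *: _); [ring|field].
have := @ler_dist0_pointwise_lipschitz R W (fun s => f (x, s) - q s) (eps * m) l.
have -> : eps * m * `|l| = eps * (`|x| * `|l| + l ^+ 2).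
  by rewrite -mulrA mulrDl -expr2 real_normK// num_real.
have -> : f (x, l) - q l - (f (x, 0) - q 0) = f (x, l) - f (x, 0) - q l.
  rewrite /q mulr0 expr0n/= mul0r !scale0r addr0 subr0; exact: addrAC.
apply => s sl.
have xsr : ball (0 : R * R) r (x, s).
  by split; rewrite /ball/= sub0r normrN// (le_lt_trans sl).
have Dxs : D (x, s) by split.
have [/= dxs Sxs] := rP _ xsr Dxs.
have {}Sxs : `|S (x, s) - (x *: u + s *: v)| <= c * m.
  apply: le_trans Sxs _; rewrite ler_pM2l// prod_normE/= ge_max.
  by rewrite lerDl normr_ge0/= (le_trans sl)// lerDr.
have cm0 : 0 < c * m by rewrite mulr_gt0.
have v1 : 0 < `|v| + 1 by rewrite ltr_wpDl.
have ts : \forall t \near nbhs s, `|t - s| < c * m / (`|v| + 1).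
  apply/nbhs_ballP; exists (c * m / (`|v| + 1)); first exact: divr_gt0.
  by move=> t; rewrite /ball/= distrC.
apply: filterS2 ts (dxs _ cm0) => t ts /(_ I) ft.
have -> : f (x, t) - q t - (f (x, s) - q s) =
    (f (x, t) - f (x, s) - (t - s) *: S (x, s))
    + ((t - s) *: (S (x, s) - (x *: u + s *: v))
    - ((t - s) ^+ 2 / 2) *: v).
  rewrite scalerBr -!addrA; congr (_ + _).
  by rewrite addKr -[X in _ = _ + X]opprD -qE !opprB addrC -addrA [RHS]addrCA.
have -> : eps * m * `|t - s| =
    c * m * `|t - s| + (c * m * `|t - s| + c * m * `|t - s|).
  by rewrite /c; field.
apply: le_trans (ler_normD _ _) _; apply: lerD => //.
apply: le_trans (ler_normB _ _) _; rewrite !normrZ; apply: lerD.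
  by rewrite mulrC ler_wpM2r.
rewrite [`|2^-1|]ger0_norm ?invr_ge0//.
move: ts; rewrite ltr_pdivlMr// => ts.
rewrite (_ : _ * _ * `|v| = `|t - s| * `|v| / 2 * `|t - s|); last by field.
rewrite ler_wpM2r//; have := normr_ge0 (t - s); have := normr_ge0 v; nra.
Qed.

(** Evenness on the axis [x = 0] removes the first-order term of the partial
    derivative in the second variable; [taylor_snd] integrates what remains. *)
Lemma taylor_snd_even (R : realType) (W : normedModType R) (E : set R)
    (f : R * R -> W) (D : set (R * R) := E `*` setT) : E 0 -> limit_point E 0 ->
  C2_within D f 0 ->
  (\forall l \near nbhs (0 : R), f (0, l) = f (0, - l)) ->
  let u := derive1_within E (fun e => derive1 (fun l => f (e, l)) 0) 0 in
  let v := derive1n 2 (fun l => f (0, l)) 0 in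
  forall eps : R, 0 < eps -> \forall z \near within D (nbhs (0 : R * R)),
    `|f z - f (z.1, 0) - ((z.1 * z.2) *: u + (z.2 ^+ 2 / 2) *: v)|
      <= eps * (`|z.1| * `|z.2| + z.2 ^+ 2).
Proof.
move=> E0 LE [B C2] feven u v.
have D0 : D 0 by split.
have [_ [_ d2] _] := nbhs_singleton C2 D0.
pose S z := diff_within D f z (0, 1).
pose A w := B 0 w (0, 1).
have AZ (k : R) w : A (k *: w) = k *: A w by exact: linearZl_LR.
have AD w w' : A (w + w') = A w + A w' by exact: linearDl.
have dS : \forall z \near within D (nbhs (0 : R * R)),
    has_deriv_within setT (fun t => f (z.1, t)) z.2 (S z).
  move: C2; rewrite !near_withinE; apply: filterS => -[x l] C2 Dxl.
  by have [df _ _] := C2 Dxl; apply: has_deriv_snd df; case: Dxl.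
have Sexp e : 0 < e -> \forall z \near within D (nbhs (0 : R * R)),
    `|S z - S 0 - A (z - 0)| <= e * `|z - 0|.
  move=> /d2; apply: filterS => z /(_ (0, 1)).
  have -> : `|(0, 1) : R * R| = 1 by rewrite prod_normE/= normr0 normr1 max_r.
  by rewrite mulr1.
clearbody S A.
have S0 : S 0 = 0.
  by apply: deriv_even0 feven _; exact: nbhs_singleton dS D0.
have dSE : \forall z \near within D (nbhs (0 : R * R)),
    S z = derive1 (fun t => f (z.1, t)) z.2.
  by apply: filterS dS => z /derive1_unique.
have uE : u = A (1, 0).
  apply: derive1_within_unique => //.
  apply: (@has_deriv_within_near_eq _ _ _ (fun e => S (e, 0))) => //.
    apply: (near_within_slice (y := fun e => (e, 0))) dSE => // t.
    by rewrite prod_normE/= normr0 ge_max normr_ge0 lexx.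
  apply: (@has_deriv_within_line _ _ _ D S A 0 (1, 0) _ _ _ AZ _ _ Sexp) => // t.
  by congr pair; rewrite /= /GRing.scale/= ?mulr0 ?addr0// mulr1 add0r subr0.
have vE : v = A (0, 1).
  apply: derive1_unique.
  apply: (@has_deriv_within_near_eq _ _ _ (fun l => S (0, l))) => //.
    apply: (near_within_slice (y := fun l => (0, l))) dSE => // t.
    by rewrite prod_normE/= normr0 ge_max normr_ge0 lexx.
  apply: (@has_deriv_within_line _ _ _ D S A 0 (0, 1) _ _ _ AZ _ _ Sexp) => // t.
  by congr pair; rewrite /= /GRing.scale/= ?mulr0 ?addr0// mulr1 add0r subr0.
apply: taylor_snd dS _ => e /Sexp; apply: filterS => -[x s].
rewrite S0 !subr0 uE vE -!AZ -AD.
have -> // : x *: (1, 0) + s *: (0, 1) = (x, s) :> R * R.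
by congr pair; rewrite /= /GRing.scale/= mulr1 mulr0 ?addr0 ?add0r.
Qed.

Unset Implicit Arguments.

Theorem theorem4p1 (d : measure_display) (T : measurableType d) (R : realType)
  (varpi : {measure set T -> \bar R}) (E : set R) (p : R -> R -> T -> R)
  (hE : E = setT \/ E = [set e | 0 <= e]) :
  let D : set (R * R) := E `*` setT in
  let Phi : R * R -> LspaceType2 varpi := sqrt_map varpi p in
  (\forall z \near within D (nbhs (0 : R, 0 : R)),
    is_density varpi (p z.1 z.2)) ->
  C2_within D Phi (0, 0) ->
  (\forall l \near nbhs (0 : R), Phi (0, l) = Phi (0, - l)) ->
  let hminus : LspaceType2 varpi :=
    derive1_within E (fun e => derive1 (fun l => Phi (e, l)) 0) 0 in
  let hplus : LspaceType2 varpi := derive1n 2 (fun l => Phi (0, l)) 0 in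
  forall z : R * R,
    Phi z - Phi (z.1, 0) =
      ((z.1 * z.2) *: hminus + (z.2 ^+ 2 / 2) *: hplus)
      +o_(z \near within D (nbhs (0 : R, 0 : R)))
        (`|z.1| * `|z.2| + z.2 ^+ 2 : R^o).
Proof.
move=> D Phi _ C2Phi evenPhi hminus hplus z.
have E0 : E 0 by case: hE => -> /=.
have LE : limit_point E 0.
  by case: hE => ->; [exact: limit_point_setT|exact: limit_point_ge0].
have taylor := taylor_snd_even E0 LE C2Phi evenPhi.
pose increment (z : R * R) := Phi z - Phi (z.1, 0).
pose main (z : R * R) :=
  (z.1 * z.2) *: hminus + (z.2 ^+ 2 / 2) *: hplus.
pose scale (z : R * R) : R^o := `|z.1| * `|z.2| + z.2 ^+ 2.
have : forall e : R, 0 < e -> \forall y \near within D (nbhs (0 : R, 0 : R)),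
    `|(increment - main) y| <= e * `|scale y|.
  move=> e e0; apply: filterS (taylor e e0) => y.
  have y0 : 0 <= `|y.1| * `|y.2| + y.2 ^+ 2 by rewrite addr_ge0 ?sqr_ge0 ?mulr_ge0.
  by have -> : `|scale y| = `|y.1| * `|y.2| + y.2 ^+ 2 by exact: ger0_norm y0.
by move=> /eqaddoP/(congr1 (@^~ z)).
Qed.
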